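(* For every integer $k\ge 1$, the group $$G(k,a,t)=\langle a,t \mid [a,\underbrace{t,\dots,t}_{k}]=1\rangle$$ is residually torsion-free nilpotent.
   Context: Commutators: $[x,y]=x^{-1}y^{-1}xy$, and $[a_1,\dots,a_{m+1}]=[[a_1,\dots,a_m],a_{m+1}]$ (left-normed). For a class $\mathcal{P}$ of groups, a group $G$ is residually $\mathcal{P}$ if for each $g\in G$, $g\ne 1$, there is a normal subgroup $N$ of $G$ with $g\notin N$ and $G/N\in\mathcal{P}$. ''Residually torsion-free nilpotent'' means residually $\mathcal{P}$ with $\mathcal{P}$ the class of torsion-free nilpotent groups. The groups $G(k,a,t)$ are called Hydra groups. *)

(* Defs.v *)
From HB Require Import structures.
From Stdlib Require Import Relations.
From mathcomp Require Import all_boot monoid.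
From mathcomp Require Import boolp classical_sets.

Set Implicit Arguments.
Unset Strict Implicit.
Unset Printing Implicit Defensive.

Local Open Scope classical_set_scope.
Local Open Scope group_scope.
Local Open Scope quotient_scope.

Definition is_subgroup (G : groupType) (H : set G) : Prop :=
  [/\ H 1, forall x y, H x -> H y -> H (x * y) & forall x, H x -> H x^-1].

Definition is_normal (G : groupType) (H : set G) : Prop :=
  is_subgroup H /\ forall x y : G, H x -> H (x ^ y).

Record normal_subgroup (G : groupType) := NormalSubgroup {
  normal_set :> G -> Prop;
  normal_setP : is_normal normal_set
}.

(* [smallest C A] is the intersection of all the sets that satisfy [C] and
   contain [A]. *)
Definition generated (G : groupType) (A : set G) : set G :=
  smallest (@is_subgroup G) A.

Lemma is_normal_smallest (G : groupType) (A : set G) :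
  is_normal (smallest (@is_normal G) A).
Proof.
split; [split=> [|x y Hx Hy|x Hx] | move=> x y Hx] => N NA;
  have [[[N1 NM NV] NJ] _] := NA.
- exact: N1.
- by apply: NM; [apply: Hx | apply: Hy].
- by apply: NV; apply: Hx.
- by apply: NJ; apply: Hx.
Qed.

Definition normal_closure (G : groupType) (A : set G) : normal_subgroup G :=
  NormalSubgroup (is_normal_smallest A).

Section Quotient.
Variables (G : groupType) (N : normal_subgroup G).

Definition same_coset (x y : G) : bool := `[< N (x^-1 * y) >].

Let N1 : N 1. Proof. by case: (normal_setP N) => -[]. Qed.
Let NM x y : N x -> N y -> N (x * y).
Proof. by case: (normal_setP N) => -[_ + _] _; apply. Qed.
Let NV x : N x -> N x^-1.
Proof. by case: (normal_setP N) => -[_ _ +] _; apply. Qed.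
Let NJ x y : N x -> N (x ^ y).
Proof. by case: (normal_setP N) => _; apply. Qed.

Lemma same_coset_equiv : equiv_class_of same_coset.
Proof.
split=> [x|x y|y x z]; first by apply/asboolP; rewrite mulVg.
  by apply/asboolP/asboolP => /NV; rewrite invgM invgK.
move=> /asboolP xy /asboolP yz; apply/asboolP.
by have := NM xy yz; rewrite -mulgA mulVKg.
Qed.

Canonical same_coset_rel := EquivRelPack same_coset_equiv.

Definition quotient_group := {eq_quot same_coset}.

HB.instance Definition _ := Choice.on quotient_group.

Definition quotient_pi (x : G) : quotient_group :=
  \pi_({eq_quot same_coset}) x.

Definition quotient_one : quotient_group := quotient_pi 1.
(* The locks only prevent unification from unfolding a product or an inverse
   into an application of [quotient_pi]. *)
Definition quotient_inv : quotient_group -> quotient_group :=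
  locked (fun u => quotient_pi (repr u)^-1).
Definition quotient_mul : quotient_group -> quotient_group -> quotient_group :=
  locked (fun u v => quotient_pi (repr u * repr v)).

Lemma quotient_eqP (x y : G) :
  quotient_pi x = quotient_pi y <-> N (x^-1 * y).
Proof.
by split=> [/eqquotP/asboolP|xy]; last by apply/eqquotP/asboolP.
Qed.

Lemma quotient_piW (P : quotient_group -> Prop) :
  (forall x, P (quotient_pi x)) -> forall u, P u.
Proof. by move=> PP u; rewrite -[u]reprK; apply: PP. Qed.

Let quotient_repr (x : G) : N ((repr (quotient_pi x))^-1 * x).
Proof. by apply/quotient_eqP/(reprK (quotient_pi x)). Qed.

Lemma quotient_piM (x y : G) :
  quotient_mul (quotient_pi x) (quotient_pi y) = quotient_pi (x * y).
Proof.
rewrite /quotient_mul -lock; apply/quotient_eqP.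
have Nx := quotient_repr x; have Ny := quotient_repr y.
set x' := repr _ in Nx *; set y' := repr _ in Ny *.
have := NM (NJ y' Nx) Ny.
by rewrite /conjg !invgM -!mulgA mulVKg.
Qed.

Lemma quotient_piV (x : G) :
  quotient_inv (quotient_pi x) = quotient_pi x^-1.
Proof.
rewrite /quotient_inv -lock; apply/quotient_eqP.
have := NJ x^-1 (NV (quotient_repr x)).
by rewrite /conjg !invgM !invgK -!mulgA mulVKg.
Qed.

Let quotient_mulA : associative quotient_mul.
Proof.
elim/quotient_piW=> x; elim/quotient_piW=> y; elim/quotient_piW=> z.
by rewrite !quotient_piM mulgA.
Qed.
Let quotient_mul1 : left_id quotient_one quotient_mul.
Proof. by elim/quotient_piW=> x; rewrite quotient_piM mul1g. Qed.
Let quotient_mulr1 : right_id quotient_one quotient_mul.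
Proof. by elim/quotient_piW=> x; rewrite quotient_piM mulg1. Qed.
Let quotient_mulV : left_inverse quotient_one quotient_inv quotient_mul.
Proof. by elim/quotient_piW=> x; rewrite quotient_piV quotient_piM mulVg. Qed.
Let quotient_mulrV : right_inverse quotient_one quotient_inv quotient_mul.
Proof. by elim/quotient_piW=> x; rewrite quotient_piV quotient_piM mulgV. Qed.

HB.instance Definition _ := isGroup.Build quotient_group
  quotient_mulA quotient_mul1 quotient_mulr1 quotient_mulV quotient_mulrV.

End Quotient.

(* The letter [(x, false)] stands for the generator [x] and [(x, true)] for its
   formal inverse. *)
Section FreeGroup.
Variable X : choiceType.

Definition word := seq (X * bool).

Inductive cancel_step : word -> word -> Prop :=
  CancelStep (u v : word) (x : X) (b : bool) :
    cancel_step (u ++ [:: (x, b); (x, ~~ b)] ++ v) (u ++ v).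

Definition free_eq : relation word := clos_refl_sym_trans word cancel_step.

Definition same_free (u v : word) : bool := `[< free_eq u v >].

Lemma same_free_equiv : equiv_class_of same_free.
Proof.
split=> [u|u v|v u w]; first exact/asboolP/rst_refl.
  by apply/asboolP/asboolP; apply: rst_sym.
by move=> /asboolP uv /asboolP vw; apply/asboolP/(rst_trans _ _ _ _ _ uv).
Qed.

Canonical same_free_rel := EquivRelPack same_free_equiv.

Definition free_group := {eq_quot same_free}.

HB.instance Definition _ := Choice.on free_group.

Definition word_inv (u : word) : word := rev [seq (l.1, ~~ l.2) | l <- u].

Definition free_pi (u : word) : free_group := \pi_({eq_quot same_free}) u.

Definition free_one : free_group := free_pi [::].
Definition free_inv : free_group -> free_group :=
  locked (fun g => free_pi (word_inv (repr g))).
Definition free_mul : free_group -> free_group -> free_group :=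
  locked (fun g h => free_pi (repr g ++ repr h)).

Lemma free_eqP (u v : word) :
  free_pi u = free_pi v <-> free_eq u v.
Proof.
by split=> [/eqquotP/asboolP|uv]; last by apply/eqquotP/asboolP.
Qed.

Lemma free_piW (P : free_group -> Prop) :
  (forall u, P (free_pi u)) -> forall g, P g.
Proof. by move=> PP g; rewrite -[g]reprK; apply: PP. Qed.

Let free_repr (u : word) : free_eq (repr (free_pi u)) u.
Proof. by apply/free_eqP/(reprK (free_pi u)). Qed.

Let free_eq_cat (u u' v v' : word) :
  free_eq u u' -> free_eq v v' -> free_eq (u ++ v) (u' ++ v').
Proof.
move=> uu' vv'; apply: (rst_trans _ _ _ (u' ++ v)).
  elim: uu' => [_ _ [w1 w2 x b]|w|w1 w2 _|w1 w2 w3 _ + _].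
  - by apply: rst_step; rewrite -!catA; apply: CancelStep.
  - exact: rst_refl.
  - exact: rst_sym.
  - exact: rst_trans.
elim: vv' => [_ _ [w1 w2 x b]|w|w1 w2 _|w1 w2 w3 _ + _].
- by apply: rst_step; rewrite !(catA u'); apply: CancelStep.
- exact: rst_refl.
- exact: rst_sym.
- exact: rst_trans.
Qed.

Let free_eq_inv (u v : word) :
  free_eq u v -> free_eq (word_inv u) (word_inv v).
Proof.
elim=> [_ _ [w1 w2 x b]|w|w1 w2 _|w1 w2 w3 _ + _].
- rewrite /word_inv !map_cat !rev_cat -catA; apply: rst_step.
  by rewrite /= negbK; apply: (CancelStep _ _ x b).
- exact: rst_refl.
- exact: rst_sym.
- exact: rst_trans.
Qed.

Let free_eq_catV (u : word) : free_eq (u ++ word_inv u) [::].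
Proof.
elim: u => [|[x b] u IHu]; first exact: rst_refl.
rewrite /word_inv /= rev_cons -cats1 -/(word_inv u) catA.
apply: (rst_trans _ _ _ ([:: (x, b)] ++ [::] ++ [:: (x, ~~ b)])).
  rewrite -cat1s; apply: free_eq_cat; first exact: rst_refl.
  by apply: free_eq_cat => //; apply: rst_refl.
by apply: rst_step; apply: (CancelStep [::] [::]).
Qed.

Let word_invK : involutive word_inv.
Proof.
move=> u; rewrite /word_inv map_rev revK -map_comp map_id_in //.
by move=> [x b] _ /=; rewrite negbK.
Qed.

Lemma free_piM (u v : word) :
  free_mul (free_pi u) (free_pi v) = free_pi (u ++ v).
Proof.
by rewrite /free_mul -lock; apply/free_eqP/free_eq_cat; apply: free_repr.
Qed.

Lemma free_piV (u : word) : free_inv (free_pi u) = free_pi (word_inv u).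
Proof. by rewrite /free_inv -lock; apply/free_eqP/free_eq_inv/free_repr. Qed.

Let free_mulA : associative free_mul.
Proof.
elim/free_piW=> u; elim/free_piW=> v; elim/free_piW=> w.
by rewrite !free_piM catA.
Qed.
Let free_mul1 : left_id free_one free_mul.
Proof. by elim/free_piW=> u; rewrite free_piM. Qed.
Let free_mulr1 : right_id free_one free_mul.
Proof. by elim/free_piW=> u; rewrite free_piM cats0. Qed.
Let free_mulrV : right_inverse free_one free_inv free_mul.
Proof.
by elim/free_piW=> u; rewrite free_piV free_piM; apply/free_eqP/free_eq_catV.
Qed.
Let free_mulV : left_inverse free_one free_inv free_mul.
Proof.
elim/free_piW=> u; rewrite free_piV free_piM; apply/free_eqP.
by have := free_eq_catV (word_inv u); rewrite word_invK.
Qed.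

HB.instance Definition _ := isGroup.Build free_group
  free_mulA free_mul1 free_mulr1 free_mulV free_mulrV.

Definition free_gen (x : X) : free_group := free_pi [:: (x, false)].

End FreeGroup.

Definition presented_group (X : choiceType) (R : set (free_group X)) :
    groupType :=
  quotient_group (normal_closure R).

(* [left_normed x [:: y1; ...; ym]] is [[~ x, y1, ..., ym]]; mathcomp's
   [[~ x, y]] is x^-1 y^-1 x y. *)
Definition left_normed (G : groupType) (x : G) (s : seq G) : G :=
  foldl (@commg G) x s.

(* The free group on [bool]: [false] is the generator a and [true] is t. *)
Definition hydra_group (k : nat) : groupType :=
  let a := free_gen false in
  let t := free_gen true in
  presented_group [set left_normed a (nseq k t)].

Fixpoint lower_central (G : groupType) (n : nat) : set G :=
  if n is m.+1 then
    generated [set [~ x, y] | x in lower_central m & y in [set: G]]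
  else [set: G].
Arguments lower_central : clear implicits.

Definition nilpotent_group (G : groupType) : Prop :=
  exists n, lower_central G n = [set 1].

Definition torsion_free (G : groupType) : Prop :=
  forall (x : G) (n : nat), 0 < n -> x ^+ n = 1 -> x = 1.

Definition residually (P : groupType -> Prop) (G : groupType) : Prop :=
  forall g : G, g <> 1 ->
    exists N : normal_subgroup G, ~ N g /\ P (quotient_group N).

Definition torsion_free_nilpotent (G : groupType) : Prop :=
  torsion_free G /\ nilpotent_group G.

(* Main.v *)
(** Put a_0 = a and a_(i+1) = [a_i, t]; then a_i^t = a_i a_(i+1) and a_k = 1,
    so the group is F . <t> with F generated by a_0, ..., a_(k-1).  Let it act
    on the noncommutative power series over int in the letters X_0, X_1, ...:
    a_i acts as left multiplication by 1 + X_i for i < k, and t^-1 as the ring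
    automorphism extending 1 + X_i |-> (1 + X_i)(1 + X_(i+1)),
    where the factor 1 + X_k is replaced by 1.  When X_i has weight i + 1, all
    these operators are unipotent for the filtration by order of vanishing.
    The elements that act trivially to depth n form a normal subgroup whose
    quotient is nilpotent by the usual commutator estimate, and torsion-free
    because the filtration quotients are.

    The action is faithful: by Magnus' argument the image of the series 1 under
    a_(i_1)^(e_1) ... a_(i_m)^(e_m), with adjacent indices distinct and nonzero
    exponents, has coefficient e_1 ... e_m at X_(i_1) ... X_(i_m), whereas t
    fixes 1; and t has infinite order because it shifts the coefficient at
    X_(k+1) by the one at X_k. *)

Require Import Defs.
From mathcomp Require Import all_boot all_algebra.
From mathcomp Require Import boolp classical_sets functions.
From mathcomp Require Import zify ring.

Set Implicit Arguments.
Unset Strict Implicit.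
Unset Printing Implicit Defensive.

Import GRing.Theory.

(** * Unipotent actions on filtered modules *)

Section FilteredAction.
Local Open Scope ring_scope.

Variables (V : zmodType) (F : nat -> V -> Prop).
Hypothesis F0 : forall e, F e 0.
Hypothesis FB : forall e u v, F e u -> F e v -> F e (u - v).
Hypothesis FS : forall e v, F e.+1 v -> F e v.
Hypothesis F_isolated : forall e n v, (0 < n)%N -> F e (v *+ n) -> F e v.

Let FN e v : F e v -> F e (- v).
Proof. by move=> Fv; rewrite -sub0r; apply: FB. Qed.

Let FD e u v : F e u -> F e v -> F e (u + v).
Proof. by move=> Fu Fv; rewrite -[v]opprK; apply: FB => //; apply: FN. Qed.

Let F_le d e v : (d <= e)%N -> F e v -> F d v.
Proof. by move=> /subnK <-; elim: (e - d)%N => // n IHn /FS. Qed.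

Definition unipotent (f : V -> V) : Prop :=
  (forall u v, f (u - v) = f u - f v) /\
  (forall e v, F e v -> F e.+1 (f v - v)).

Lemma unipotent_id : unipotent id.
Proof. by split=> // e v _; rewrite subrr. Qed.

Lemma unipotent_pres f : unipotent f -> forall e v, F e v -> F e (f v).
Proof.
by move=> [_ fF] e v Fv; rewrite -(subrK v (f v)); apply: FD => //; apply/FS/fF.
Qed.

Lemma unipotent_comp f g : unipotent f -> unipotent g -> unipotent (f \o g).
Proof.
move=> fU gU; split=> [u v|e v Fv] /=; first by rewrite gU.1 fU.1.
rewrite -(subrK (g v) (f (g v))) -addrA; apply: FD; last exact: gU.2.
exact/fU.2/unipotent_pres.
Qed.

(** As f (g v) = v, g v differs from v by f (g v) - g v; so g v climbs from [F d] to [F d.+1] as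
    long as d < e, starting from [F 0], which is everything. *)
Lemma unipotent_inv f g : (forall v, F 0 v) -> cancel f g -> cancel g f ->
  unipotent f -> unipotent g.
Proof.
move=> F00 fK gK fU; split=> [u v|e v Fv].
  by apply: (can_inj fK); rewrite fU.1 !gK.
have Fg d : (d <= e)%N -> F d (g v).
  elim: d => // d IHd ltde; have := fU.2 _ _ (IHd (ltnW ltde)).
  rewrite gK => Fd; rewrite -(subrK v (g v)); apply: FD; last exact: F_le Fv.
  by rewrite -opprB; apply: FN.
by rewrite -opprB -{1}[v]gK; apply/FN/fU.2/Fg.
Qed.

Variables (G : groupType) (rho : G -> V -> V).
Hypothesis rho1 : forall v, rho 1%g v = v.
Hypothesis rhoM : forall g h v, rho (g * h)%g v = rho g (rho h v).
Hypothesis rhoU : forall g, unipotent (rho g).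

Let rhoK g v : rho g^-1%g (rho g v) = v.
Proof. by rewrite -rhoM mulVg rho1. Qed.

Let rhoF g e v : F e v -> F e (rho g v).
Proof. exact: unipotent_pres. Qed.

Let rhoB g u v : rho g (u - v) = rho g u - rho g v.
Proof. exact: (rhoU g).1. Qed.

(** The gain d is required at every level e, not only at 0; this is what makes commutators gain
    depth. *)
Definition deep (d : nat) : set G :=
  fun g => forall e v, F e v -> F (e + d) (rho g v - v).

Lemma deep1 g : deep 1 g.
Proof. by move=> e v Fv; rewrite addn1; apply: (rhoU g).2. Qed.

Lemma deepS d g : deep d.+1 g -> deep d g.
Proof. by move=> gD e v Fv; apply: FS; rewrite -addnS; apply: gD. Qed.

Lemma deep_normal d : is_normal (deep d).
Proof.
split; first split.
- by move=> e v _; rewrite rho1 subrr.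
- move=> x y Dx Dy e v Fv; rewrite rhoM.
  rewrite -(subrK (rho y v) (rho x _)) -addrA; apply: FD; last exact: Dy.
  exact/Dx/rhoF.
- move=> x Dx e v Fv; rewrite -{2}[v](rhoK x) -rhoB.
  by apply: rhoF; rewrite -opprB; apply/FN/Dx.
- move=> x y Dx e v Fv; rewrite /conjg !rhoM -{2}[v](rhoK y) -rhoB.
  exact/rhoF/Dx/rhoF.
Qed.

(** As operators, [x, y] - 1 = (yx)^-1 ((x - 1)(y - 1) - (y - 1)(x - 1)); in each product x - 1
    gains d and y - 1 gains 1. *)
Lemma deep_commg d x y : deep d x -> deep d.+1 [~ x, y]%g.
Proof.
move=> Dx e v Fv; have -> : [~ x, y]%g = ((y * x)^-1 * (x * y))%g.
  by rewrite /commg /conjg invgM !mulgA.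
rewrite rhoM -{2}[v](rhoK (y * x)%g) -rhoB; apply: rhoF; rewrite !rhoM.
have -> : rho x (rho y v) - rho y (rho x v) =
    (rho x (rho y v - v) - (rho y v - v)) -
    (rho y (rho x v - v) - (rho x v - v)).
  rewrite !rhoB -(addrA (rho x (rho y v))) -(addrA (rho y (rho x v))) -!opprD.
  by rewrite (addrCA (rho y v)) opprB [RHS]addrA subrK.
apply: FB.
  by rewrite addnS -addSn; apply/Dx/(rhoU y).2.
by rewrite addnS; apply: (rhoU y).2; apply: Dx.
Qed.

(** Induction on depth: if x has depth d and u = x v - v, then x^n v - v agrees with n u to one
    order more, and [F_isolated] divides by n. *)
Lemma deep_isolated d n x : (0 < d)%N -> (0 < n)%N -> deep d (x ^+ n)%g ->
  deep d x.
Proof.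
move=> + n_gt0; elim: d => // -[_ _ _|d IHd _ Dxn]; first exact: deep1.
have /(_ isT (deepS Dxn)) Dx := IHd.
move=> e v Fv; apply: (F_isolated n_gt0).
set u := rho x v - v; have Fu : F (e + d.+1) u by apply: Dx.
suff Dm m : F (e + d.+2) (rho (x ^+ m)%g v - v - u *+ m).
  rewrite -(subKr (rho (x ^+ n)%g v - v) (u *+ n)).
  by apply: FB => //; apply: Dxn.
elim: m => [|m IHm]; first by rewrite rho1 subrr subr0.
have -> : rho (x ^+ m.+1)%g v - v - u *+ m.+1 =
    (rho (x ^+ m)%g u - u) + (rho (x ^+ m)%g v - v - u *+ m).
  rewrite expgSr rhoM /u rhoB mulrSr -/u opprD (addrC (- _) (- u)).
  by rewrite !addrA; congr (_ - _); rewrite -(addrAC _ (rho _ v)) subrK addrAC.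
by apply: FD => //; rewrite addnS; apply: (rhoU _).2.
Qed.

Lemma deep_quotient d (N : normal_subgroup G) : N = deep d.+1 :> (G -> Prop) ->
  torsion_free_nilpotent (quotient_group N).
Proof.
move=> defN; have NE x : N x <-> deep d.+1 x by rewrite defN.
have pi1 x : quotient_pi N x = 1%g <-> deep d.+1 x.
  rewrite -NE; split=> [/esym/quotient_eqP|Nx]; first by rewrite invg1 mul1g.
  by apply/esym/quotient_eqP; rewrite invg1 mul1g.
have piM x y : quotient_pi N (x * y)%g = (quotient_pi N x * quotient_pi N y)%g.
  exact/esym/quotient_piM.
have piV x : quotient_pi N x^-1%g = (quotient_pi N x)^-1%g.
  exact/esym/quotient_piV.
split.
  elim/quotient_piW=> x n n_gt0.
  have -> : (quotient_pi N x ^+ n)%g = quotient_pi N (x ^+ n)%g.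
    by elim: n {n_gt0} => // n IHn; rewrite !expgS piM IHn.
  by rewrite !pi1; apply: deep_isolated.
(* The lower central series is numbered from 0 and every element has depth 1, hence the shift by
   one. *)
have lowerP m : (lower_central (quotient_group N) m `<=`
    [set u | exists2 x, u = quotient_pi N x & deep m.+1 x])%classic.
  elim: m => [|m IHm] /=.
    by elim/quotient_piW=> x _; exists x => //; apply: deep1.
  apply: smallest_sub.
    have [[D1 DM DV] _] := deep_normal m.+2.
    split; first by exists 1%g.
    - move=> _ _ [x -> Dx] [y -> Dy].
      by exists (x * y)%g; [rewrite piM | apply: DM].
    - by move=> _ [x -> Dx]; exists x^-1%g; [rewrite piV | apply: DV].
  move=> _ [u1 /IHm [x -> Dx] [v _ <-]]; elim/quotient_piW: v => y.
  exists [~ x, y]%g; last exact: deep_commg.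
  by rewrite /commg /conjg !piM !piV.
exists d; apply/seteqP; split=> u /=.
  by case/lowerP => x -> /pi1.
move=> ->; case: (d) => [|m] //= K [[K1 _ _] _]; exact: K1.
Qed.

Lemma residually_filtered :
  (forall g, g <> 1%g -> exists d, ~ deep d.+1 g) ->
  residually torsion_free_nilpotent G.
Proof.
move=> sep g /sep[d Dg].
by exists (NormalSubgroup (deep_normal d.+1)); split=> //; apply: deep_quotient.
Qed.

End FilteredAction.
(** * Actions of presented groups *)

Section PresentedAction.
Local Open Scope group_scope.

Variables (X : choiceType) (T : Type) (op : X * bool -> T -> T).
Hypothesis opK : forall x b, cancel (op (x, b)) (op (x, ~~ b)).

Let act_free_eq u v : free_eq u v -> forall z, foldr op z u = foldr op z v.
Proof.
elim=> [_ _ [w1 w2 x b]|//|w1 w2 _ IH|w1 w2 w3 _ IH1 _ IH2] z.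
- by rewrite !foldr_cat /= -{1}[b]negbK opK.
- exact/esym/IH.
- by rewrite IH1.
Qed.

Definition free_act (g : free_group X) (z : T) : T := foldr op z (repr g).

Lemma free_act_pi u z : free_act (free_pi u) z = foldr op z u.
Proof. exact/act_free_eq/free_eqP/(reprK (free_pi u)). Qed.

Lemma free_act1 z : free_act 1 z = z.
Proof. exact: free_act_pi. Qed.

Lemma free_actM g h z : free_act (g * h) z = free_act g (free_act h z).
Proof.
elim/free_piW: g => u; elim/free_piW: h => v.
have -> : free_pi u * free_pi v = free_pi (u ++ v) by apply: free_piM.
by rewrite !free_act_pi foldr_cat.
Qed.

Lemma free_act_gen x z : free_act (free_gen x) z = op (x, false) z.
Proof. exact: free_act_pi. Qed.

Definition presented_gen (R : set (free_group X)) (x : X) : presented_group R :=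
  quotient_pi _ (free_gen x).

(** The elements acting trivially form a normal subgroup, so it contains the normal closure of the
    relators. *)
Lemma presented_act (R : set (free_group X)) :
    (forall r, R r -> forall z, free_act r z = z) ->
  exists rho : presented_group R -> T -> T,
    [/\ forall z, rho 1 z = z,
        forall g h z, rho (g * h) z = rho g (rho h z) &
        forall x z, rho (presented_gen R x) z = op (x, false) z].
Proof.
move=> Ract; pose K : set (free_group X) := fun g => forall z, free_act g z = z.
have K_normal : is_normal K.
  have KV g : K g -> K g^-1.
    by move=> Kg z; rewrite -{1}[z]Kg -free_actM mulVg free_act1.
  split; first split=> //; first exact: free_act1.
    by move=> g h Kg Kh z; rewrite free_actM Kh Kg.
  by move=> g h Kg z; rewrite /conjg !free_actM Kg -free_actM mulVg free_act1.
have subK g : normal_closure R g -> K g by apply: smallest_sub.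
pose rho (u : presented_group R) := free_act (repr (u : quotient_group _)).
have rho_pi g z : rho (quotient_pi _ g) z = free_act g z.
  have /quotient_eqP/subK Kg : quotient_pi (normal_closure R)
    (repr (quotient_pi (normal_closure R) g)) = quotient_pi _ g by exact: reprK.
  by rewrite -[z in LHS]Kg /rho -free_actM mulVKg.
exists rho; split=> [z|g h z|x z]; first by rewrite rho_pi free_act1.
  elim/quotient_piW: g => g; elim/quotient_piW: h => h.
  rewrite !rho_pi -free_actM -rho_pi; congr rho; exact: quotient_piM.
by rewrite rho_pi free_act_gen.
Qed.

Lemma presented_ind (R : set (free_group X)) (P : presented_group R -> Prop) :
    P 1 -> (forall g x, P g -> P (g * presented_gen R x)) ->
    (forall g x, P g -> P (g * (presented_gen R x)^-1)) ->
  forall g, P g.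
Proof.
move=> P1 PM PV; elim/quotient_piW; elim/free_piW.
elim/last_ind => // u [x b] IHu.
pose q v : presented_group R := quotient_pi (normal_closure R) (free_pi v).
have qE : q (rcons u (x, b)) = q u * q [:: (x, b)].
  rewrite -cats1 /q; have -> : free_pi (u ++ [:: (x, b)]) =
    free_pi u * free_pi [:: (x, b)] by exact/esym/free_piM.
  exact/esym/quotient_piM.
rewrite -/(q _) qE; case: b {qE}; last exact: PM.
have -> : q [:: (x, true)] = (presented_gen R x)^-1; last exact: PV.
rewrite /q; have -> : free_pi [:: (x, true)] = (free_gen x)^-1.
  exact/esym/free_piV.
exact/esym/quotient_piV.
Qed.
End PresentedAction.

(** * Operators on noncommutative power series *)

Section Series.
Local Open Scope ring_scope.

Definition series := seq nat -> int.

Definition weight (w : seq nat) : nat := sumn [seq i.+1 | i <- w].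

Definition order_ge (e : nat) (f : series) : Prop :=
  forall w, (weight w < e)%N -> f w = 0.

Definition left_coef (j : nat) (f : series) : series := fun w => f (j :: w).

Definition mulX (i : nat) (f : series) : series :=
  fun w => if w is j :: w' then (j == i)%:R * f w' else 0.

Variable k : nat.

(* The operator [mul1X i] below is 1 + X_i for [i != k] and the identity for
   [i = k], as required by a_k = 1.  The letters X_i with [k <= i] belong to no
   generator; they make t act with infinite order even when k = 1. *)
Definition xcoef (i : nat) : int := (i != k)%:R.
(** Coefficient of X_i in the image of X_(i-1) under [Phi] below; it is cut off at i = 0, where
    [i.-1] is again 0. *)
Definition dcoef (i : nat) : int := ((0 < i)%N && (i != k))%:R.

Definition mul1X (i : nat) (f : series) : series :=
  fun w => f w + xcoef i * mulX i f w.

Fixpoint div1X (i : nat) (f : series) (w : seq nat) : int :=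
  if w is j :: w' then f w - xcoef i * (j == i)%:R * div1X i f w' else f [::].

(* The ring endomorphism sending X_i to
   X_i + xcoef (i+1) (X_(i+1) + X_i X_(i+1)), computed on left coefficients. *)
Fixpoint Phi (f : series) (w : seq nat) : int :=
  if w is j :: w' then
    Phi (left_coef j f) w' + dcoef j * Phi (left_coef j.-1 f) w' +
    (if w' is i :: w'' then
      xcoef j.+1 * (i == j.+1)%:R * Phi (left_coef j f) w'' else 0)
  else f [::].

(* [Psi_coef f j] is the solution h_j of
   (1 + xcoef (j+1) X_(j+1)) h_j + dcoef j h_(j-1) = left_coef j f, which by
   [Phi_cons] is the equation satisfied by [Phi (left_coef j (Psi f))]. *)
Fixpoint Psi_coef (f : series) (j : nat) : series :=
  div1X j.+1 (fun w => f (j :: w) -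
    if j is i.+1 then dcoef j * Psi_coef f i w else 0).

Fixpoint Psi (f : series) (w : seq nat) : int :=
  if w is j :: w' then Psi (Psi_coef f j) w' else f [::].

Lemma mul1XK i : cancel (mul1X i) (div1X i).
Proof.
move=> f; apply: funext; elim=> [|j w IHw] /=.
  by rewrite /mul1X mulr0 addr0.
by rewrite IHw /mul1X /= mulrA addrK.
Qed.

Lemma div1XK i : cancel (div1X i) (mul1X i).
Proof.
move=> f; apply: funext => -[|j w] /=; first by rewrite /mul1X mulr0 addr0.
by rewrite /mul1X /= mulrA subrK.
Qed.

Lemma Phi_cons f j w :
  Phi f (j :: w) = mul1X j.+1 (Phi (left_coef j f)) w +
                   dcoef j * Phi (left_coef j.-1 f) w.
Proof.
by rewrite /mul1X /=; case: w => [|i w]; rewrite ?mulr0 ?addr0 // addrAC mulrA.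
Qed.

Arguments Phi : simpl never.

(** [Phi] at a word refers to words shorter by one and by two letters, so the induction is on
    length. *)
Lemma size_ind (P : seq nat -> Prop) :
  (forall w, (forall v, (size v < size w)%N -> P v) -> P w) -> forall w, P w.
Proof.
move=> IH w; move: {2}(size w) (leqnn (size w)) => n.
elim: n w => [|n IHn] w le_wn; apply: IH => v lt_vw.
  by move: (leq_trans lt_vw le_wn).
exact/IHn/(leq_trans lt_vw le_wn).
Qed.

Lemma eq_mul1X i f g w : (forall v, (size v <= size w)%N -> f v = g v) ->
  mul1X i f w = mul1X i g w.
Proof.
rewrite /mul1X => fg; rewrite fg //; case: w fg => //= j w fg.
by rewrite fg // ltnW.
Qed.

Lemma PsiK : cancel Psi Phi.
Proof.
move=> f; apply: funext => w; elim/size_ind: w f => -[|j w] IHw f //.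
rewrite Phi_cons (@eq_mul1X _ _ (Psi_coef f j)) => [|v le_vw]; last first.
  by rewrite (_ : left_coef _ _ = Psi (Psi_coef f j)) // IHw.
rewrite (_ : left_coef j.-1 _ = Psi (Psi_coef f j.-1)) // IHw //.
by case: j {IHw} => [|j] /=; rewrite div1XK ?subr0 ?subrK // /dcoef mul0r addr0.
Qed.

(** By [Phi_cons] the series [Phi (left_coef j f)] satisfy the recursion in j that defines
    [Psi_coef (Phi f)], and its solution is unique. *)
Lemma PhiK : cancel Phi Psi.
Proof.
move=> f; apply: funext => w; elim: w f => //= j w IHw f.
suff -> : Psi_coef (Phi f) j = Phi (left_coef j f) by rewrite IHw.
elim: j => [|j IHj] /=.
  rewrite -[RHS](@mul1XK 1); congr div1X; apply: funext => v.
  by rewrite Phi_cons subr0 /dcoef mul0r addr0.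
rewrite -[RHS](@mul1XK j.+2); congr div1X; apply: funext => v.
by rewrite Phi_cons IHj addrK.
Qed.

Lemma PhiB f g : Phi (f - g) = Phi f - Phi g.
Proof.
apply: funext => w; elim/size_ind: w f g => -[|j w] IHw f g //.
rewrite !Phi_cons.
have E i : forall v, (size v <= size w)%N -> Phi (left_coef i (f - g)) v =
    (Phi (left_coef i f) - Phi (left_coef i g)) v by move=> v ?; rewrite -IHw.
rewrite (eq_mul1X _ (E j)) E // /mul1X.
rewrite -[(Phi f - Phi g) _]/(Phi f _ - Phi g _) !Phi_cons /mul1X.
by case: w {IHw E} => [|i w] /=; rewrite !fctE; ring.
Qed.

Lemma Phi0 : Phi 0 = 0.
Proof. by rewrite -[X in Phi X](subrr 0) PhiB subrr. Qed.

Lemma PhiD f g : Phi (f + g) = Phi f + Phi g.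
Proof. by rewrite -[X in _ + X]opprK -[- g]sub0r !PhiB Phi0 sub0r opprK. Qed.

(** Multiplicativity against a single letter on the left: all left coefficients of X_i f vanish
    except the one at i, which is f. *)
Lemma Phi_mulX i f w :
  Phi (mulX i f) w = mulX i (mul1X i.+1 (Phi f)) w +
                     xcoef i.+1 * mulX i.+1 (Phi f) w.
Proof.
case: w => [|j w]; first by rewrite /= mulr0 addr0.
have E l : left_coef l (mulX i f) = if l == i then f else 0.
  apply: funext => v; rewrite /left_coef /mulX.
  by case: eqP; rewrite ?mul1r ?mul0r.
rewrite Phi_cons !E /=; have [->|neq_ji] := eqVneq j i.
  rewrite mul1r (ltn_eqF (ltnSn i)) mul0r mulr0; congr (_ + _).
  by case: i {E} => [|i] /=; rewrite ?mul0r // (ltn_eqF (ltnSn i)) Phi0 mulr0.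
rewrite Phi0 /mul1X (_ : mulX _ 0 w = 0); last first.
  by case: w => //= *; rewrite mulr0.
rewrite mulr0 mul0r !add0r; case: j neq_ji => [|j] neq_ji /=.
  by rewrite /dcoef !mul0r mulr0.
rewrite eqSS /dcoef /xcoef; case: (eqVneq j i) => [->|_].
  by rewrite mul1r.
by rewrite Phi0 mul0r !mulr0.
Qed.

(** With t acting as [Psi], this is the relation a_i^t = a_i a_(i+1) between operators. *)
Lemma Phi_mul1X i f : i != k ->
  Phi (mul1X i f) = mul1X i (mul1X i.+1 (Phi f)).
Proof.
move=> ik; have mul1XE g : mul1X i g = g + mulX i g.
  by apply: funext => w; rewrite /mul1X /xcoef ik mul1r.
rewrite !mul1XE PhiD; apply: funext => w; rewrite !fctE Phi_mulX /mul1X.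
by rewrite addrCA addrC addrAC addrC.
Qed.

(** * The filtration by order of vanishing *)

Lemma order_ge0 e : order_ge e 0.
Proof. by []. Qed.

Lemma order_geB e f g : order_ge e f -> order_ge e g -> order_ge e (f - g).
Proof. by move=> fe ge w lt_we; rewrite !fctE fe // ge // subrr. Qed.

Lemma order_geS e f : order_ge e.+1 f -> order_ge e f.
Proof. by move=> fe w /ltnW; apply: fe. Qed.

Lemma order_ge_isolated e n f : (0 < n)%N -> order_ge e (f *+ n) ->
  order_ge e f.
Proof.
move=> n_gt0 fe w /fe/eqP.
have -> : (f *+ n) w = f w *+ n.
  by elim: n {n_gt0 fe} => [|n IHn]; rewrite ?mulr0n // !mulrS -IHn.
by rewrite Num.Theory.mulrn_eq0 (gtn_eqF n_gt0) => /eqP.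
Qed.

Lemma mul1X_unipotent i : unipotent order_ge (mul1X i).
Proof.
split=> [f g|e f fe [|j w] lt_we]; rewrite ?fctE /mul1X.
- by apply: funext => -[|j w] /=; rewrite ?fctE /=; ring.
- by rewrite /= mulr0 addr0 subrr.
rewrite addrAC subrr add0r /=; case: eqVneq => [_|]; last first.
  by rewrite mul0r mulr0.
rewrite fe ?mulr0 //; move: lt_we; rewrite /weight /=; lia.
Qed.

Lemma left_coef_order e j f : order_ge e f ->
  order_ge (e - j.+1) (left_coef j f).
Proof.
by move=> fe w lt_we; apply: fe; move: lt_we; rewrite /weight /=; lia.
Qed.

(** At a word of weight at most e only f w survives: the two other terms of [Phi] evaluate the image
    of a left coefficient at a weight below its order. *)
Lemma Phi_unipotent : unipotent order_ge Phi.
Proof.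
split=> [f g|e f fe w]; first exact: PhiB.
rewrite ltnS fctE => le_we; apply/eqP; rewrite subr_eq0; apply/eqP.
elim/size_ind: w e f fe le_we => -[|j w] // IHw e f fe le_we.
have {}IHw v d g : (size v <= size w)%N -> order_ge d g -> (weight v <= d)%N ->
    Phi g v = g v by move=> le_vw; apply: IHw.
move: le_we; rewrite /weight /= -/(weight w) => le_we.
have fj := left_coef_order (j := j) fe.
have fj1 := left_coef_order (j := j.-1) fe.
rewrite Phi_cons {1}/mul1X (IHw _ _ _ _ fj) //; last by lia.
have Phi_vanish v d g : (size v <= size w)%N -> order_ge d g ->
    (weight v < d)%N -> Phi g v = 0.
  by move=> le_vw gd lt_vd; rewrite (IHw _ _ _ _ gd) ?gd // ltnW.
have -> : dcoef j * Phi (left_coef j.-1 f) w = 0.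
  case: j fj1 le_we {fj} => [|j] /= fj1 le_we; first by rewrite /dcoef mul0r.
  by rewrite (Phi_vanish _ _ _ _ fj1) ?mulr0 //; lia.
rewrite addr0 -[RHS]addr0; congr (_ + _).
case: w le_we {IHw} Phi_vanish => [|i w] le_we Phi_vanish /=.
  by rewrite mulr0.
rewrite (Phi_vanish _ _ _ _ fj) ?mulr0 //; move: le_we; rewrite /weight /=; lia.
Qed.

Lemma Psi_unipotent : unipotent order_ge Psi.
Proof.
apply: (unipotent_inv _ _ _ _ PhiK PsiK) Phi_unipotent => //.
- exact: order_geB.
- exact: order_geS.
Qed.

Definition series1 : series := fun w => (w == [::])%:R.

Lemma Phi1 : Phi series1 = series1.
Proof.
apply: funext => -[|j w] //; rewrite Phi_cons.
rewrite (_ : left_coef _ _ = 0) // (_ : left_coef _ _ = 0) // Phi0.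
by rewrite mulr0 addr0 /mul1X; case: w => [|i w] /=; rewrite !mulr0 addr0.
Qed.

Lemma Psi1 : Psi series1 = series1.
Proof. by rewrite -{1}Phi1 PhiK. Qed.

(** A unitriangular 2 by 2 matrix on the coefficients at u and v; composition adds the entries e, so
    exponents can be read off. *)
Definition shear (u v : seq nat) (e : int) (phi : series -> series) : Prop :=
  forall f, phi f u = f u /\ phi f v = f v + e * f u.

Lemma shear_mul1X i w : i != k -> ohead w != Some i ->
  shear w (i :: w) 1 (mul1X i).
Proof.
move=> ik iw f; split; last by rewrite /mul1X /xcoef ik /= eqxx !mul1r.
case: w iw => [|j w] /= iw; rewrite /mul1X /= ?mulr0 ?addr0 //.
have /negPf-> : j != i by apply: contra_neq iw => ->.
by rewrite mul0r mulr0 addr0.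
Qed.

Lemma shear_can u v e phi psi : cancel psi phi ->
  shear u v e phi -> shear u v (- e) psi.
Proof.
move=> psiK phiS f; have [] := phiS (psi f).
by rewrite psiK => <- ->; split=> //; rewrite mulNr addrK.
Qed.

(** Under [Phi], X_k receives nothing from X_(k-1) because a_k = 1, while X_(k+1) receives X_k; the
    sign comes from inverting. *)
Lemma shear_Psi : shear [:: k] [:: k.+1] (-1) Psi.
Proof.
apply: shear_can PsiK _ => f; rewrite !Phi_cons /mul1X /= !mulr0 !addr0 /dcoef.
by rewrite eqxx andbF mul0r addr0 /= (gtn_eqF (ltnSn k)).
Qed.

End Series.

(** * Integer powers of group elements that act as shears *)

Section ShearPowers.
Variables (G : groupType) (rho : G -> series -> series).
Hypothesis rho1 : forall f, rho 1%g f = f.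
Hypothesis rhoM : forall g h f, rho (g * h)%g f = rho g (rho h f).
Local Open Scope ring_scope.

Lemma shear_expgn u v e x n : shear u v e (rho x) ->
  shear u v (n%:Z * e) (rho (x ^+ n)%g).
Proof.
move=> xS f; elim: n => [|n [IHu IHv]]; first by rewrite rho1 mul0r mul0r addr0.
have [xu xv] := xS (rho (x ^+ n)%g f).
by rewrite expgS rhoM xu xv IHu IHv; split=> //; rewrite intS; ring.
Qed.

Lemma shear_inv u v e x : shear u v e (rho x) -> shear u v (- e) (rho x^-1%g).
Proof.
by apply: shear_can => f; rewrite -rhoM mulgV rho1.
Qed.

(** Here and below, x^m / x^n with natural m and n stands for the integer power x^(m-n). *)
Lemma shear_divg u v e x m n : shear u v e (rho x) ->
  shear u v ((m%:Z - n%:Z) * e) (rho (x ^+ m / x ^+ n)%g).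
Proof.
move=> xS f; have /shear_inv nS := shear_expgn n xS.
have [] := shear_expgn m xS (rho (x ^- n)%g f); have [-> ->] := nS f.
by rewrite -rhoM => -> ->; split=> //; ring.
Qed.

End ShearPowers.

(** * Normal form and faithfulness *)

Section IteratedCommutators.
Variables (k : nat) (G : groupType) (a t : G) (rho : G -> series -> series).
Local Open Scope group_scope.
Hypothesis rho1 : forall f, rho 1 f = f.
Hypothesis rhoM : forall g h f, rho (g * h) f = rho g (rho h f).
Hypothesis rho_a : forall f, rho a f = mul1X k 0 f.
Hypothesis rho_t : forall f, rho t f = Psi k f.

Definition itcomm (i : nat) : G := left_normed a (nseq i t).

Lemma itcommS i : itcomm i.+1 = [~ itcomm i, t].
Proof. by rewrite /itcomm -addn1 nseqD /left_normed foldl_cat. Qed.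

Lemma itcommJ i : itcomm i ^ t = itcomm i * itcomm i.+1.
Proof. by rewrite itcommS /commg mulVKg. Qed.

(** In [x, t] = x^-1 x^t the factor 1 + X_i cancels by [Phi_mul1X]. The case i = k gives the
    identity; applied in the free group, it shows that the relator acts trivially. *)
Lemma rho_itcomm i : i <= k -> forall f, rho (itcomm i) f = mul1X k i f.
Proof.
elim: i => [_ f|i IHi lt_ik f]; first exact: rho_a.
have {}IHi := IHi (ltnW lt_ik).
have rhoV x f1 f2 : rho x f2 = f1 -> rho x^-1 f1 = f2.
  by move=> <-; rewrite -rhoM mulVg rho1.
rewrite itcommS /commg /conjg !rhoM rho_t IHi; apply: (rhoV).
rewrite IHi; apply/esym/rhoV; rewrite rho_t -{1}[f](@PsiK k).
by rewrite -Phi_mul1X ?(ltn_eqF lt_ik) // PhiK.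
Qed.

Hypothesis itcommk : itcomm k = 1.

Lemma itcomm_ge i : k <= i -> itcomm i = 1.
Proof.
move=> /subnK <-; elim: (i - k) => // n IHn.
by rewrite addSn itcommS IHn comm1g.
Qed.

Definition itcomm_group : set G := generated (range itcomm).

Lemma itcomm_group_subgroup : is_subgroup itcomm_group.
Proof.
split=> [|x y Hx Hy|x Hx] K KP; have [[K1 KM KV] _] := KP => //.
- by apply: KM; [apply: Hx | apply: Hy].
- by apply: KV; apply: Hx.
Qed.

Let itcomm_in i : itcomm_group (itcomm i).
Proof. by move=> K [_ subK]; apply: subK; exists i. Qed.

Lemma itcomm_groupJ x y : (forall i, itcomm_group (itcomm i ^ y)) ->
  itcomm_group x -> itcomm_group (x ^ y).
Proof.
have [H1 HM HV] := itcomm_group_subgroup => Hy.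
apply: (smallest_sub (X := [set x | itcomm_group (x ^ y)]%classic)).
  split=> [|x1 x2|x1] /=; first by rewrite conj1g.
    by rewrite conjMg; apply: HM.
  by rewrite conjVg; apply: HV.
by move=> _ [i _ <-]; apply: Hy.
Qed.

Lemma itcomm_groupJt x : itcomm_group x -> itcomm_group (x ^ t).
Proof.
have [_ HM _] := itcomm_group_subgroup.
by apply: itcomm_groupJ => i; rewrite itcommJ; apply: HM.
Qed.

(** Descending induction from a_k = 1: conjugating a_i^t = a_i a_(i+1) by t^-1 expresses the
    conjugate of a_i through a_i and the conjugate of a_(i+1). *)
Lemma itcomm_groupJtV x : itcomm_group x -> itcomm_group (x ^ t^-1).
Proof.
have [H1 HM HV] := itcomm_group_subgroup.
apply: itcomm_groupJ => i.
have [n] : exists n, k <= i + n by exists k; rewrite leq_addl.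
elim: n i => [|n IHn] i le_kin.
  by rewrite itcomm_ge ?conj1g // -[i]addn0.
have -> : itcomm i ^ t^-1 = itcomm i * (itcomm i.+1 ^ t^-1)^-1.
  apply: (canRL (mulgK _)); rewrite -conjMg -itcommJ; exact: conjgK.
by apply: HM => //; apply: HV; apply: IHn; rewrite addSnnS.
Qed.

Lemma divgXM (x : G) m n p q :
  x ^+ m / x ^+ n * (x ^+ p / x ^+ q) = x ^+ (m + p) / x ^+ (n + q).
Proof.
rewrite [n + q]addnC !expgnDr invgM !mulgA; congr (_ * _).
rewrite -!mulgA; congr (_ * _); apply/commute_sym/commuteV.
exact/commuteX2/commute_refl.
Qed.

Lemma itcomm_groupJtX x m n : itcomm_group x ->
  itcomm_group (x ^ (t ^+ m / t ^+ n)).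
Proof.
move=> Hx; rewrite conjgM.
have {}Hx : itcomm_group (x ^ (t ^+ m)).
  elim: m => [|m IHm]; first by rewrite conjg1.
  by rewrite expgSr conjgM; apply: itcomm_groupJt.
rewrite -expVgn; elim: n => [|n IHn]; first by rewrite conjg1.
by rewrite expgSr conjgM; apply: itcomm_groupJtV.
Qed.

Definition split_form (g : G) : Prop :=
  exists h m n, itcomm_group h /\ g = h * (t ^+ m / t ^+ n).

Lemma split_form_mula b g : split_form g -> itcomm_group b ->
  split_form (g * b).
Proof.
have [_ HM _] := itcomm_group_subgroup.
(* Moving b to the left past s = t^m / t^n conjugates it by s^-1. *)
move=> [h [m [n [Hh ->]]]] Hb; exists (h * b ^ (t ^+ n / t ^+ m)), m, n; split.
  by apply: HM => //; apply: itcomm_groupJtX.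
by rewrite -!mulgA; congr (_ * _); rewrite !mulgA conjgCV invgF -!mulgA.
Qed.

Lemma split_form_mult p q g : split_form g ->
  split_form (g * (t ^+ p / t ^+ q)).
Proof.
move=> [h [m [n [Hh ->]]]]; exists h, (m + p), (n + q); split=> //.
by rewrite -mulgA divgXM.
Qed.

(** Only the indices of the syllables are recorded: they spell the word whose coefficient will
    detect the product. *)
Inductive reduced_product : seq nat -> G -> Prop :=
| ReducedNil : reduced_product [::] 1
| ReducedCons i m n w h : i < k -> m != n -> ohead w != Some i ->
    reduced_product w h ->
    reduced_product (i :: w) (itcomm i ^+ m / itcomm i ^+ n * h).

Lemma reduced_productM i m n w h : i < k -> reduced_product w h ->
  exists v, reduced_product v (itcomm i ^+ m / itcomm i ^+ n * h).
Proof.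
move=> lt_ik wh; have [->|neq_mn] := eqVneq m n.
  by exists w; rewrite mulgV mul1g.
have [|wi] := eqVneq (ohead w) (Some i); last by exists (i :: w); constructor.
case: wh => // j p q v h' lt_jk _ vj vh' [eq_ji].
rewrite {j}eq_ji in lt_jk vj *.
rewrite mulgA divgXM; have [->|neq] := eqVneq (m + p) (n + q).
  by exists v; rewrite mulgV mul1g.
by exists (i :: v); constructor.
Qed.

Lemma itcomm_group_reduced h : itcomm_group h -> exists w, reduced_product w h.
Proof.
pose stable x := forall w g, reduced_product w g ->
  exists v, reduced_product v (x * g).
have stable1 : stable 1 by move=> w g wg; exists w; rewrite mul1g.
have stableM x y : stable x -> stable y -> stable (x * y).
  by move=> xP yP w g /yP[v /xP]; rewrite mulgA.
(* Stability is not visibly closed under inverses, so h and h^-1 are carried together. *)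
move=> Hh; suff [hS _] : stable h /\ stable h^-1.
  by have [w] := hS _ _ ReducedNil; rewrite mulg1; exists w.
move: h Hh.
apply: (smallest_sub (X := [set h | stable h /\ stable h^-1]%classic)).
  split=> [|x y [xS xVS] [yS yVS]|x [xS xVS]] /=; rewrite ?invg1 //.
    by rewrite invgM; split; apply: stableM.
  by rewrite invgK.
move=> _ [i _ <-] /=; case: (ltnP i k) => [lt_ik|/itcomm_ge->]; last first.
  by rewrite invg1.
split=> w g /(reduced_productM _ _ lt_ik) wg.
  by have := wg 1%N 0; rewrite expg1 expg0 invg1 mulg1.
by have := wg 0 1%N; rewrite expg1 expg0 mul1g.
Qed.

Definition alternating (w : seq nat) : bool := sorted (fun i j => i != j) w.

Lemma alternating_cons i w :
  alternating (i :: w) = (ohead w != Some i) && alternating w.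
Proof. by case: w => //= j w; rewrite eq_sym. Qed.

Lemma reduced_alternating w h : reduced_product w h -> alternating w.
Proof.
by elim=> // i m n v g _ _ vi _ vP; rewrite alternating_cons vi.
Qed.

Let shear_itcomm i w m n : i < k -> ohead w != Some i ->
  shear w (i :: w) (m%:Z - n%:Z)%R (rho (itcomm i ^+ m / itcomm i ^+ n)).
Proof.
move=> lt_ik wi; rewrite -[X in shear _ _ X]mulr1; apply: shear_divg => // f.
rewrite rho_itcomm ?(ltnW lt_ik) //.
by apply: shear_mul1X; rewrite ?(ltn_eqF lt_ik).
Qed.

(** An alternating word takes at most one letter from each syllable. Other words can be longer,
    since (1 + X_i)^e has terms with X_i repeated. *)
Lemma reduced_coef_long w h : reduced_product w h ->
  forall v, alternating v -> size w < size v -> rho h series1 v = 0%R.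
Proof.
elim=> [[] // *|i m n w' g lt_ik _ _ _ IH [//|j v]]; first by rewrite rho1.
rewrite alternating_cons ltnS rhoM => /andP[vj v_alt] lt_wv.
have [eq_ji|neq_ji] := eqVneq j i; last first.
  have jv : ohead (j :: v) != Some i by apply: contra_neq neq_ji => -[].
  have [-> _] := shear_itcomm m n lt_ik jv (rho g series1).
  by rewrite IH ?(ltnW lt_wv) ?alternating_cons ?vj //= ltnS ltnW.
rewrite eq_ji in vj *; have [_ ->] := shear_itcomm m n lt_ik vj (rho g series1).
by rewrite !IH ?alternating_cons ?vj //= ?mulr0 ?addr0 // ltnS ltnW.
Qed.

(** The first syllable adds its nonzero exponent times the coefficient of the rest at v; the rest
    has coefficient 0 at [i :: v] by length. *)
Lemma reduced_coef w h : reduced_product w h -> rho h series1 w != 0%R.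
Proof.
elim=> [|i m n v g lt_ik neq_mn vi vg IHg]; first by rewrite rho1.
rewrite rhoM; have [_ ->] := shear_itcomm m n lt_ik vi (rho g series1).
rewrite (reduced_coef_long vg) //; last first.
  by rewrite alternating_cons vi (reduced_alternating vg).
by rewrite add0r mulf_neq0 // subr_eq0.
Qed.

Lemma split_form_faithful g : split_form g -> (forall f, rho g f = f) -> g = 1.
Proof.
move=> [h [m [n [/itcomm_group_reduced[w wh] ->]]]] triv.
have rho_tX p : rho (t ^+ p) series1 = series1.
  by elim: p => [|p IHp]; rewrite ?rho1 // expgS rhoM IHp rho_t Psi1.
have rho_s : rho (t ^+ m / t ^+ n) series1 = series1.
  by rewrite rhoM -{1}(rho_tX n) -(rhoM (t ^- n)) mulVg rho1 rho_tX.
(* Now h alone fixes the series 1, which therefore has a nonzero coefficient at w; so w is empty and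
   h = 1. *)
have := reduced_coef wh; have := triv series1; rewrite rhoM rho_s => ->.
case: wh triv => // triv _; rewrite mul1g.
have tS : shear [:: k] [:: k.+1] (-1) (rho t).
  by move=> f; rewrite rho_t; apply: shear_Psi.
(* Applied to the series X_k, the shear shows n - m as the coefficient at X_(k+1), which must be
   0. *)
have [_] := shear_divg rho1 rhoM m n tS (mulX k series1).
have := triv (mulX k series1); rewrite mul1g => -> /=.
move=> eq_mn.
suff -> : m = n by rewrite mulgV.
by move: eq_mn; rewrite /= /series1 eqxx /= (gtn_eqF (ltnSn k)); lia.
Qed.

End IteratedCommutators.

(** * The Hydra group: its relation, its unipotent action and separation *)

Section Hydra.
Variable k : nat.
Local Open Scope group_scope.

Let relators : set (free_group bool) :=
  [set left_normed (free_gen false) (nseq k (free_gen true))]%classic.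
Let a : hydra_group k := presented_gen relators false.
Let t : hydra_group k := presented_gen relators true.

Lemma hydra_itcomm : itcomm a t k = 1.
Proof.
have pi_itcomm i : itcomm a t i =
    quotient_pi (normal_closure relators)
      (itcomm (free_gen false) (free_gen true) i).
  elim: i => // i IHi; rewrite !itcommS IHi /commg /conjg.
  set x := itcomm _ _ _.
  have qM y z : quotient_pi (normal_closure relators) (y * z) =
    (quotient_pi (normal_closure relators) y : hydra_group k) *
    quotient_pi (normal_closure relators) z by exact/esym/quotient_piM.
  have qV y : quotient_pi (normal_closure relators) y^-1 =
    (quotient_pi (normal_closure relators) y : hydra_group k)^-1
    by exact/esym/quotient_piV.
  by rewrite !qM !qV.
rewrite pi_itcomm; apply/esym/quotient_eqP; rewrite invg1 mul1g.
by move=> K [_ subK]; apply: subK.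
Qed.

Lemma hydra_split_form : forall g : hydra_group k, split_form a t g.
Proof.
have [H1 _ HV] := itcomm_group_subgroup a t.
have Ha : itcomm_group a t a by move=> K [_ subK]; apply: subK; exists 0.
apply: presented_ind => [|g [] gP|g [] gP].
- by exists 1, 0, 0; split; last by rewrite mulgV mul1g.
- by have := split_form_mult 1%N 0 gP; rewrite expg1 expg0 invg1 mulg1.
- by apply: split_form_mula => //; apply: hydra_itcomm.
- by have := split_form_mult 0 1%N gP; rewrite expg1 expg0 mul1g.
- by apply: split_form_mula; [apply: hydra_itcomm | | apply: HV].
Qed.

Lemma hydra_act : exists rho : hydra_group k -> series -> series,
  [/\ forall f, rho 1 f = f,
      forall g h f, rho (g * h) f = rho g (rho h f),
      forall f, rho a f = mul1X k 0 f,
      forall f, rho t f = Psi k f &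
      forall g, unipotent order_ge (rho g)].
Proof.
pose op (l : bool * bool) : series -> series :=
  if l.1 then (if l.2 then Phi k else Psi k)
  else (if l.2 then div1X k 0 else mul1X k 0).
have opK x b : cancel (op (x, b)) (op (x, ~~ b)).
  by case: x b => -[]; [exact: PhiK|exact: PsiK|exact: div1XK|exact: mul1XK].
have [_ -> f|rho [rho1 rhoM rho_gen]] := presented_act opK (R := relators).
  rewrite (rho_itcomm (free_act1 opK) (free_actM opK) _ _ (leqnn k)).
  - by rewrite /mul1X /xcoef eqxx; apply: funext => w; rewrite mul0r addr0.
  - by move=> g; rewrite free_act_gen.
  - by move=> g; rewrite free_act_gen.
exists rho; split=> //; try by move=> f; apply: rho_gen.
have UC := unipotent_comp order_ge0 order_geB order_geS.
have UM g h : unipotent order_ge (rho g) -> unipotent order_ge (rho h) ->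
    unipotent order_ge (rho (g * h)).
  move=> gU hU; rewrite (_ : rho (g * h) = rho g \o rho h); first exact: UC.
  exact/funext/rhoM.
have UV g : unipotent order_ge (rho g) -> unipotent order_ge (rho g^-1).
  apply: (unipotent_inv order_ge0 order_geB order_geS) => // f.
    by rewrite -rhoM mulVg rho1.
  by rewrite -rhoM mulgV rho1.
have genU x : unipotent order_ge (rho (presented_gen relators x)).
  rewrite (_ : rho _ = op (x, false)); last exact/funext/rho_gen.
  by case: x; [apply: Psi_unipotent | apply: mul1X_unipotent].
apply: presented_ind => [|g x gU|g x gU].
- rewrite (_ : rho 1 = id); last exact/funext/rho1.
  exact: unipotent_id order_ge0.
- exact: UM.
- exact/UM/UV.
Qed.

Lemma hydra_residually : residually torsion_free_nilpotent (hydra_group k).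
Proof.
have [rho [rho1 rhoM rho_a rho_t rhoU]] := hydra_act.
apply: (residually_filtered order_ge0 order_geB order_geS _ rho1 rhoM rhoU).
  exact: order_ge_isolated.
move=> g g_neq1; apply: contrapT => shallow; apply: g_neq1.
apply: (split_form_faithful rho1 rhoM rho_a rho_t hydra_itcomm).
  exact: hydra_split_form.
move=> f; apply: funext => w; apply/eqP; rewrite -subr_eq0; apply/eqP.
(* Every series has order at least 0, so depth [(weight w).+1] forces g f - f to vanish at w. *)
have gD : deep order_ge rho (weight w).+1 g.
  by apply: contrapT => ?; apply: shallow; exists (weight w).
by apply: (gD 0 f).
Qed.

End Hydra.

Theorem theorem1 (k : nat) (hk : 1 <= k) :
  residually torsion_free_nilpotent (hydra_group k).
Proof. exact: hydra_residually. Qed.
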